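(* Let $k\ge 1$ be an integer. If $\tau_1$ and $\tau_2$ are both $k$-inflatable permutations, then their tensor product $\tau_1[\tau_2]$ is also $k$-inflatable.
   Context: A permutation of length $n\ge 1$ is a bijection of $[n]=\{1,\dots,n\}$; $S_n$ is the set of these and $|\tau|$ denotes the length of $\tau$. A tuple $(a_1,\dots,a_k)$ of distinct integers is order-isomorphic to $\pi\in S_k$ if $a_i<a_j \iff \pi(i)<\pi(j)$ for all $i,j$. The density $t(\pi,\tau)$ of $\pi\in S_k$ in a permutation $\tau$ with $|\tau|\ge k$ is the probability that the restriction of $\tau$ to a uniformly random $k$-element subset of its indices (listed in increasing order of index) is order-isomorphic to $\pi$. Tensor product: for $\tau\in S_n$, $\gamma\in S_m$, $\tau[\gamma]\in S_{nm}$ is given by $\tau[\gamma]((i-1)m+j)=(\tau(i)-1)m+\gamma(j)$ for $i\in[n]$, $j\in[m]$. The random inflation of $\tau$ is the sequence of random permutations $\tau[\lambda_1],\tau[\lambda_2],\ldots$, where $\lambda_\ell$ is uniformly distributed on $S_\ell$ for each $\ell\ge1$ (all on a common probability space). A sequence of permutations $\{\tau_j\}$ with $|\tau_j|\to\infty$ whose pattern densities $t(\pi,\tau_j)$ all converge is called $k$-symmetric if $\lim_{j} t(\pi,\tau_j)=1/k!$ for every $\pi\in S_k$. A permutation $\tau$ is $k$-inflatable if its random inflation is (almost surely) $k$-symmetric. *)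

(* Defs.v *)
From HB Require Import structures.
From mathcomp Require Import all_boot all_order all_algebra all_fingroup.
From mathcomp Require Import all_classical all_reals all_analysis.

Set Implicit Arguments.
Unset Strict Implicit.
Unset Printing Implicit Defensive.

Import Order.TTheory GRing.Theory Num.Theory.
Import numFieldNormedType.Exports.

Local Open Scope classical_set_scope.
Local Open Scope ring_scope.

(** A permutation of length [n] is an element of ['S_n]: positions and values
    are numbered from 0, hence one less than in the usual convention. *)

Definition order_isomorphic (k : nat) (a : seq nat) (pi : 'S_k) : bool :=
  (size a == k) &&
  [forall i : 'I_k, forall j : 'I_k,
    (nth 0%N a i < nth 0%N a j)%N == (pi i < pi j)%N].

(** [enum A] lists the indices in increasing order. *)
Definition restriction (n : nat) (tau : 'S_n) (A : {set 'I_n}) : seq nat :=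
  [seq nat_of_ord (tau i) | i <- enum A].

(** The value is 0, as a junk value, when [n < k]. *)
Definition density (R : realType) (k n : nat) (pi : 'S_k) (tau : 'S_n) : R :=
  #|[set A : {set 'I_n} | (#|A| == k) &&
      order_isomorphic (restriction tau A) pi]%SET|%:R / 'C(n, k)%:R.

Section Tensor.
Variables n m : nat.

Lemma block_subproof (i : 'I_(n * m)) : (i %/ m < n)%N.
Proof. by rewrite ltn_divLR //; case: m i => [|//] [i]; rewrite muln0. Qed.

Lemma offset_subproof (i : 'I_(n * m)) : (i %% m < m)%N.
Proof. by rewrite ltn_mod; case: m i => [|//] [i]; rewrite muln0. Qed.

Lemma pos_subproof (i : 'I_n) (j : 'I_m) : (i * m + j < n * m)%N.
Proof.
have lt_im : (i.+1 * m <= n * m)%N by rewrite leq_mul2r ltn_ord orbT.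
by apply: leq_trans lt_im; rewrite mulSn addnC ltn_add2r.
Qed.

Definition block (i : 'I_(n * m)) : 'I_n := Ordinal (block_subproof i).
Definition offset (i : 'I_(n * m)) : 'I_m := Ordinal (offset_subproof i).
Definition pos (i : 'I_n) (j : 'I_m) : 'I_(n * m) := Ordinal (pos_subproof i j).

Lemma block_pos i j : block (pos i j) = i.
Proof.
apply: val_inj => /=; have m_gt0 : (0 < m)%N by apply: leq_ltn_trans (ltn_ord j).
by rewrite divnMDl // divn_small ?addn0.
Qed.

Lemma offset_pos i j : offset (pos i j) = j.
Proof. by apply: val_inj; rewrite /= modnMDl modn_small. Qed.

Lemma pos_block_offset i : pos (block i) (offset i) = i.
Proof. by apply: val_inj; rewrite /= -divn_eq. Qed.

Definition tensor_fun (tau : 'S_n) (gamma : 'S_m) (i : 'I_(n * m)) :=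
  pos (tau (block i)) (gamma (offset i)).

Lemma tensor_fun_inj tau gamma : injective (tensor_fun tau gamma).
Proof.
move=> x y exy; rewrite -(pos_block_offset x) -(pos_block_offset y).
congr pos; [apply: (@perm_inj _ tau) | apply: (@perm_inj _ gamma)].
  by rewrite -[LHS](block_pos _ (gamma (offset x))) -/(tensor_fun _ _ _) exy block_pos.
by rewrite -[LHS](offset_pos (tau (block x))) -/(tensor_fun _ _ _) exy offset_pos.
Qed.

Definition tensor (tau : 'S_n) (gamma : 'S_m) : 'S_(n * m) :=
  perm (@tensor_fun_inj tau gamma).

Lemma tensorE tau gamma (i : 'I_n) (j : 'I_m) :
  nat_of_ord (tensor tau gamma (pos i j)) = (tau i * m + gamma j)%N.
Proof. by rewrite permE /tensor_fun block_pos offset_pos. Qed.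

End Tensor.

Definition k_symmetric (R : realType) (k : nat) (N : nat -> nat)
    (tau : forall j, 'S_(N j)) : Prop :=
  [/\ N j @[j --> \oo] --> \oo,
      forall (m : nat) (pi : 'S_m), (0 < m)%N ->
        cvg (density R pi (tau j) @[j --> \oo])
    & forall pi : 'S_k,
        density R pi (tau j) @[j --> \oo] --> (k`!%:R^-1 : R)].

(** Measurability is with respect to the discrete sigma-algebra on ['S_l]. *)
Definition uniform_random_perm (R : realType) (d : measure_display)
    (Omega : measurableType d) (P : probability Omega R) (l : nat)
    (lambda : Omega -> 'S_l) : Prop :=
  forall sigma : 'S_l,
    measurable (lambda @^-1` [set sigma]) /\
    P (lambda @^-1` [set sigma]) = (l`!%:R^-1)%:E.

(** [lambda l] has length [l.+1], so the sequence starts at length 1. *)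
Definition random_inflation (Omega : Type) (n : nat) (tau : 'S_n)
    (lambda : forall l, Omega -> 'S_l.+1) (w : Omega) (l : nat) :
    'S_(n * l.+1) :=
  tensor tau (lambda l w).

(** The joint law of the [lambda l] is left arbitrary: only their marginals are
    prescribed, so the almost sure statement is required for every coupling.
    Such couplings exist, e.g. independent ones or ones on the unit interval. *)
Definition k_inflatable (R : realType) (k n : nat) (tau : 'S_n) : Prop :=
  forall (d : measure_display) (Omega : measurableType d)
    (P : probability Omega R) (lambda : forall l, Omega -> 'S_l.+1),
    (forall l, uniform_random_perm P (lambda l)) ->
    {ae P, forall w, k_symmetric R k (random_inflation tau lambda w)}.

(* Main.v *)
Require Import Defs.
From mathcomp Require Import all_boot all_order all_algebra all_fingroup.
From mathcomp Require Import all_classical all_reals all_analysis.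
From mathcomp Require Import measurable_realfun ring.

(** Points of [tau[sigma]] are pairs (block, offset).  When [k] points have
    pairwise distinct offsets, the pattern they form depends on [sigma] only
    through the pattern [rho] in ['S_k] that [sigma] takes on those [k]
    offsets, even when the points lie in different blocks, because every block
    carries the same copy of [sigma].  Coinciding offsets have probability
    [O(1/m)] when [sigma] has length [m].  Hence the transfer formula: there
    are weights [w pi rho], depending on [tau] but not on [sigma], such that
      [t(pi, tau[sigma]) = sum over rho in S_k of w pi rho * t(rho, sigma)]
    up to an error that vanishes as [m] grows ([density_tensor_close],
    [cvg_transfer_error]).  It is linear in the densities of [sigma] and
    involves patterns of length [k] only.

    Linearity lets the formula be averaged over a uniform [sigma], for which
    every [t(rho, sigma)] has mean [1/k!] ([mean_density]).  If [tau] is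
    [k]-inflatable then, by dominated convergence, the mean of
    [t(pi, tau[sigma])] tends to [1/k!] ([inflatable_mean_density]), so the
    weights [w pi rho] sum to 1 over [rho] ([sum_transfer_weight]).  No
    concentration estimate for random permutations is involved.

    Now write the inflation of [tau1[tau2]] as [tau1[tau2[lambda]]].  Almost
    surely all densities of [tau2[lambda]] converge, so the transfer formula
    for [tau1] makes all densities of [tau1[tau2[lambda]]] converge; those of
    length [k] tend to a weighted sum of copies of [1/k!] whose weights have
    sum 1. *)

Set Implicit Arguments.
Unset Strict Implicit.
Unset Printing Implicit Defensive.

Import Order.TTheory GRing.Theory Num.Theory.
Import numFieldNormedType.Exports.

(** * Relative order and standardization *)

Definition same_order (k m m' : nat) (f : 'I_k -> 'I_m) (g : 'I_k -> 'I_m') :=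
  [forall i, forall j, (f i < f j)%N == (g i < g j)%N].

Lemma same_orderP k m m' (f : 'I_k -> 'I_m) (g : 'I_k -> 'I_m') :
  reflect (forall i j, (f i < f j)%N = (g i < g j)%N) (same_order f g).
Proof.
apply: (iffP forallP) => [h i j|h i]; first by move/forallP/(_ j)/eqP: (h i).
by apply/forallP => j; apply/eqP.
Qed.

Lemma same_order_inj k m m' (f : 'I_k -> 'I_m) (g : 'I_k -> 'I_m') :
  same_order f g -> injective f -> injective g.
Proof.
move=> /same_orderP fg f_inj i j gij; apply: f_inj; apply: val_inj.
by case: (ltngtP (f i) (f j)) => //; rewrite fg gij ltnn.
Qed.

Lemma card_lt_ord k (i : 'I_k) : #|[set j : 'I_k | (j < i)%N]| = i.
Proof.
pose w := widen_ord (ltnW (ltn_ord i)).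
have w_inj : injective w by move=> x y [] /val_inj.
rewrite -[RHS]card_ord -(card_imset _ w_inj).
apply: eq_card => j; rewrite inE; apply/idP/imsetP => [lt_ji|[x _ ->]].
  by exists (Ordinal lt_ji) => //; apply: val_inj.
exact: (ltn_ord x).
Qed.

Lemma perm_rank k (alpha : 'S_k) i :
  #|[set j | (alpha j < alpha i)%N]| = alpha i.
Proof.
rewrite -[RHS]card_lt_ord -(card_imset _ (@perm_inj _ alpha)).
apply: eq_card => j; rewrite inE; apply/imsetP/idP => [[x + ->]|lt_ji].
  by rewrite inE.
by exists (alpha^-1 j)%g; rewrite ?inE permKV.
Qed.

(** A permutation is recovered from its order relation, its value at [i] being
    the number of smaller values. *)
Lemma same_order_perm_eq k (alpha beta : 'S_k) :
  same_order alpha beta -> alpha = beta.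
Proof.
move=> /same_orderP ab; apply/permP => i; apply: val_inj => /=.
rewrite -(perm_rank alpha) -(perm_rank beta).
by apply: eq_card => j; rewrite !inE ab.
Qed.

(** The rank of [h i] among the values of [h] defines the permutation. *)
Lemma standardization_exists k m (h : 'I_k -> 'I_m) :
  injective h -> exists alpha : 'S_k, same_order alpha h.
Proof.
move=> h_inj.
pose below i := [set j | (h j < h i)%N].
have rank_lt i : (#|below i| < k)%N.
  rewrite -[X in (_ < X)%N]card_ord -cardsT proper_card // properT.
  by apply/negP => /eqP e; have := finset.in_setT i; rewrite -e inE ltnn.
pose rank i := Ordinal (rank_lt i).
have mono i j : (h i < h j)%N -> (rank i < rank j)%N.
  move=> hij; apply: proper_card; apply/properP; split.
    by apply/fintype.subsetP => x; rewrite !inE => /ltn_trans; apply.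
  by exists i; rewrite !inE ?ltnn.
have rankE i j : (rank i < rank j)%N = (h i < h j)%N.
  apply/idP/idP => [|/mono //]; apply: contraTT; rewrite -!leqNgt.
  rewrite leq_eqVlt => /orP[/eqP /val_inj /h_inj -> //|/mono /ltnW //].
have rank_inj : injective rank.
  move=> i j rij; apply: h_inj; apply: val_inj.
  by case: (ltngtP (h i) (h j)) => //; rewrite -rankE rij ltnn.
by exists (perm rank_inj); apply/same_orderP => i j; rewrite !permE rankE.
Qed.

(** The identity is a junk value, taken when [h] is not injective. *)
Definition standardization k m (h : 'I_k -> 'I_m) : 'S_k :=
  odflt 1%g [pick alpha : 'S_k | same_order alpha h].

Lemma standardization_eq k m (h : 'I_k -> 'I_m) (alpha : 'S_k) :
  injective h -> (standardization h == alpha) = same_order alpha h.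
Proof.
move=> h_inj; rewrite /standardization; case: pickP => [beta bh|no_perm].
  apply/eqP/idP => [<- //|ah]; apply: same_order_perm_eq.
  apply/same_orderP => i j.
  by rewrite (same_orderP _ _ bh) (same_orderP _ _ ah).
by have [beta] := standardization_exists h_inj; rewrite no_perm.
Qed.

(** * Occurrences as increasing maps *)

Definition increasing k m (g : 'I_k -> 'I_m) : bool := same_order id g.

Lemma increasingE k m (g : 'I_k -> 'I_m) :
  increasing g -> forall i j, (g i < g j)%N = (i < j)%N.
Proof. by move=> /same_orderP h i j; rewrite h. Qed.

Lemma increasing_inj k m (g : 'I_k -> 'I_m) : increasing g -> injective g.
Proof. by move=> /same_order_inj; apply; exact: inj_id. Qed.

Lemma enum_ord_sorted m (A : {set 'I_m}) :
  sorted (fun x y : 'I_m => (x < y)%N) (enum A).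
Proof.
rewrite /enum_mem; apply: sorted_filter; first by move=> x y z; apply: ltn_trans.
by have := iota_ltn_sorted 0 m; rewrite -enumT -val_enum_ord sorted_map.
Qed.

(** Both sides are the sorted list of the same elements, so an increasing map
    is determined by its image. *)
Lemma increasing_enum k m (g : 'I_k -> 'I_m) :
  increasing g -> enum [set g i | i : 'I_k] = [seq g i | i <- enum 'I_k].
Proof.
move=> inc_g.
apply: (@irr_sorted_eq _ (fun x y : 'I_m => (x < y)%N)).
- by move=> x y z; apply: ltn_trans.
- by move=> x; rewrite /= ltnn.
- exact: enum_ord_sorted.
- rewrite sorted_map (@eq_sorted _ _ (relpre val ltn)).
    by have := iota_ltn_sorted 0 k; rewrite -val_enum_ord sorted_map.
  by move=> i j /=; rewrite (increasingE inc_g).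
move=> x; rewrite mem_enum; apply/imsetP/mapP => [[i _ ->]|[i _ ->]].
  by exists i; rewrite ?mem_enum.
by exists i.
Qed.

Lemma nth_enum_increasing m (A : {set 'I_m}) x0 i j :
  (i < #|A|)%N -> (j < #|A|)%N ->
  (nth x0 (enum A) i < nth x0 (enum A) j)%N = (i < j)%N.
Proof.
rewrite cardE => Ai Aj.
have lt i' j' : (j' < size (enum A))%N -> (i' < j')%N ->
    (nth x0 (enum A) i' < nth x0 (enum A) j')%N.
  move=> Aj' ij'.
  apply: (sorted_ltn_nth _ _ (enum_ord_sorted A)) => //.
    by move=> x y z; apply: ltn_trans.
  by rewrite inE (ltn_trans ij').
apply/idP/idP => [|/lt -> //]; apply: contraTT; rewrite -!leqNgt.
by rewrite leq_eqVlt => /orP[/eqP -> //|/(lt _ _ Ai) /ltnW].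
Qed.

(** Subsets of size [k] correspond to increasing maps through their image,
    which turns the sets that define densities into maps. *)
Lemma card_subsets_increasing k m (Q : {set 'I_m} -> bool) :
  #|[set A : {set 'I_m} | (#|A| == k) && Q A]| =
  #|[set g : {ffun 'I_k -> 'I_m} |
      increasing g && Q [set g i | i : 'I_k]]|.
Proof.
rewrite -(@card_in_imset _ _
  (fun g : {ffun 'I_k -> 'I_m} => [set g i | i : 'I_k])); last first.
  move=> f g; rewrite !inE => /andP[inc_f _] /andP[inc_g _] fg.
  apply/ffunP => i.
  have : [seq f i | i <- enum 'I_k] = [seq g i | i <- enum 'I_k].
    by rewrite -!increasing_enum // fg.
  by move/eq_in_map => /(_ i); rewrite mem_enum; apply.
apply: eq_card => A; rewrite inE; apply/andP/imsetP => [[/eqP Ak QA]|].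
  pose g : {ffun 'I_k -> 'I_m} :=
    [ffun i => enum_val (cast_ord (esym Ak) i)].
  have gA : A = [set g i | i : 'I_k].
    apply/setP => x; apply/idP/imsetP => [xA|[i _ ->]].
      exists (cast_ord Ak (enum_rank_in xA x)) => //.
      by rewrite ffunE cast_ordK enum_rankK_in.
    by rewrite ffunE enum_valP.
  exists g => //; rewrite inE -gA QA andbT.
  apply/same_orderP => i j; rewrite !ffunE !(enum_val_nth (g i)).
  by rewrite nth_enum_increasing //= Ak.
move=> [g]; rewrite inE => /andP[inc_g Qg] ->; split => //.
by rewrite card_imset ?card_ord //; apply: increasing_inj.
Qed.

Lemma card_increasing k m :
  #|[set g : {ffun 'I_k -> 'I_m} | increasing g]| = 'C(m, k).
Proof.
have := @card_subsets_increasing k m xpredT.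
under eq_finset do rewrite andbT.
rewrite card_draws card_ord => ->.
by apply: eq_card => g; rewrite !inE andbT.
Qed.

Definition occurrence k n (pi : 'S_k) (tau : 'S_n) (g : 'I_k -> 'I_n) : bool :=
  increasing g && same_order pi (tau \o g).

Definition occurrences k n (pi : 'S_k) (tau : 'S_n) : {set {ffun 'I_k -> 'I_n}} :=
  [set g | occurrence pi tau (g : {ffun _ -> _})].

Lemma density_occurrences (R : realType) k n (pi : 'S_k) (tau : 'S_n) :
  density R pi tau = (#|occurrences pi tau|%:R / 'C(n, k)%:R)%R.
Proof.
rewrite /density card_subsets_increasing; congr (_%:R / _)%R.
apply: eq_card => g; rewrite !inE /occurrence.
have [inc_g|//] := boolP (increasing g).
rewrite /order_isomorphic /restriction increasing_enum // -map_comp.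
rewrite size_map size_enum_ord eqxx /=.
have nthE (i : 'I_k) :
    nth 0%N [seq ((fun i => nat_of_ord (tau i)) \o g) i | i <- enum 'I_k] i = tau (g i).
  by rewrite (nth_map i) ?size_enum_ord // nth_ord_enum.
apply/forallP/same_orderP => [h i j|h i].
  by have /forallP/(_ j)/eqP := h i; rewrite !nthE.
by apply/forallP => j; rewrite !nthE h.
Qed.

(** * Occurrences in a tensor product *)

(** Positions are ordered lexicographically by block, then offset; since the
    values of a tensor product are positions too, this also compares values. *)
Lemma ltn_pos n m (b b' : 'I_n) (o o' : 'I_m) :
  (pos b o < pos b' o')%N = (b < b')%N || (b == b') && (o < o')%N.
Proof.
have lt (c c' : 'I_n) (p p' : 'I_m) : (c < c')%N -> (pos c p < pos c' p')%N.
  move=> cc'; rewrite /= (@leq_trans (c.+1 * m)) //.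
    by rewrite mulSn addnC ltn_add2r.
  by rewrite (@leq_trans (c' * m)) ?leq_addr // leq_mul2r cc' orbT.
have [bb'|b'b|/val_inj ->] := ltngtP b b'.
- by rewrite lt.
- have -> : (b == b') = false by apply/eqP => e; rewrite e ltnn in b'b.
  by apply/negbTE; rewrite -leqNgt ltnW // lt.
by rewrite eqxx /= ltn_add2l.
Qed.

Definition spread k n m (b : 'I_k -> 'I_n) (o : 'I_k -> 'I_m) (i : 'I_k) :=
  pos (b i) (o i).

(** The key invariance: comparing points of [tau[sigma]] uses [sigma] only
    through comparisons of offsets and of their images, and these are the same
    for the offsets [g \o alpha] in [sigma] as for [alpha] in [rho]. *)
Lemma occurrence_spread k n m (pi : 'S_k) (tau : 'S_n) (sigma : 'S_m)
    (rho : 'S_k) (b : 'I_k -> 'I_n) (g : 'I_k -> 'I_m) (alpha : 'I_k -> 'I_k) :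
  occurrence rho sigma g ->
  occurrence pi (tensor tau sigma) (spread b (g \o alpha)) =
  occurrence pi (tensor tau rho) (spread b alpha).
Proof.
move=> /andP[inc_g /same_orderP rho_g].
rewrite /occurrence /increasing; congr andb.
  apply/same_orderP/same_orderP => h i j; rewrite h /spread !ltn_pos /=;
  by rewrite (increasingE inc_g).
have E i j : (tensor tau sigma (spread b (g \o alpha) i) <
              tensor tau sigma (spread b (g \o alpha) j))%N =
   (tensor tau rho (spread b alpha i) < tensor tau rho (spread b alpha j))%N.
  rewrite !permE /tensor_fun !block_pos !offset_pos !ltn_pos /=.
  by rewrite rho_g.
by apply/same_orderP/same_orderP => h i j; rewrite h /= E.
Qed.

(** The occurrences of [pi] in [tau[rho]] whose [k] points have distinct
    offsets, hence use every offset exactly once, in an order [alpha]. *)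
Definition transfer_count k n (pi : 'S_k) (tau : 'S_n) (rho : 'S_k) : nat :=
  \sum_(b : {ffun 'I_k -> 'I_n}) \sum_(alpha : 'S_k)
    occurrence pi (tensor tau rho) (spread b alpha).

(** An injective map factors uniquely as a permutation followed by an
    increasing map. *)
Lemma sum_injective k m (F : {ffun 'I_k -> 'I_m} -> nat) :
  (\sum_(o : {ffun 'I_k -> 'I_m} | injectiveb o) F o =
   \sum_(alpha : 'S_k) \sum_(g : {ffun 'I_k -> 'I_m} | increasing g)
     F [ffun i => g (alpha i)])%N.
Proof.
(* For a fixed order type [alpha], composing with [alpha] is a bijection from
   increasing maps to the maps with this order type. *)
rewrite (partition_big (fun o : {ffun 'I_k -> 'I_m} => standardization o) predT) //=.
apply: eq_bigr => alpha _.
rewrite (reindex_onto (fun g : {ffun 'I_k -> 'I_m} => [ffun i => g (alpha i)])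
  (fun o : {ffun 'I_k -> 'I_m} => [ffun i => o (alpha^-1 i)%g])) /=; last first.
  by move=> o _; apply/ffunP => i; rewrite !ffunE permK.
apply: eq_bigl => g.
have -> : [ffun i => [ffun i0 => g (alpha i0)] (alpha^-1 i)%g] = g.
  by apply/ffunP => i; rewrite !ffunE permKV.
rewrite eqxx andbT; apply/andP/idP => [[/injectiveP inj_ga]|inc_g].
  rewrite standardization_eq // => /same_orderP a_ga.
  apply/same_orderP => i j; have := a_ga (alpha^-1 i)%g (alpha^-1 j)%g.
  by rewrite !ffunE !permKV.
have inj_ga : injective [ffun i => g (alpha i)].
  by move=> i j; rewrite !ffunE => /(increasing_inj inc_g) /perm_inj.
split; first exact/injectiveP.
rewrite standardization_eq //; apply/same_orderP => i j.
by rewrite !ffunE (increasingE inc_g).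
Qed.

Lemma sum_increasing k m (sigma : 'S_m) (F : {ffun 'I_k -> 'I_m} -> nat) :
  (\sum_(g : {ffun 'I_k -> 'I_m} | increasing g) F g =
   \sum_(rho : 'S_k) \sum_(g in occurrences rho sigma) F g)%N.
Proof.
rewrite (partition_big (fun g : {ffun 'I_k -> 'I_m} =>
  standardization (sigma \o g)) predT) //=.
apply: eq_bigr => rho _; apply: eq_bigl => g; rewrite inE /occurrence.
have [inc_g|//] := boolP (increasing g).
by rewrite standardization_eq //; apply: inj_comp (@perm_inj _ _) (increasing_inj _).
Qed.

Lemma occurrence_eq k n (pi : 'S_k) (tau : 'S_n) (f g : 'I_k -> 'I_n) :
  f =1 g -> occurrence pi tau f = occurrence pi tau g.
Proof.
move=> fg; rewrite /occurrence /increasing; congr andb;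
  by apply/same_orderP/same_orderP => h i j; rewrite h /= !fg.
Qed.

Lemma card_occurrences_tensor k n m (pi : 'S_k) (tau : 'S_n) (sigma : 'S_m) :
  (#|occurrences pi (tensor tau sigma)| =
   \sum_(b : {ffun 'I_k -> 'I_n}) \sum_(o : {ffun 'I_k -> 'I_m})
     occurrence pi (tensor tau sigma) (spread b o))%N.
Proof.
rewrite -sum1_card pair_big /=.
rewrite (reindex (fun p : {ffun 'I_k -> 'I_n} * {ffun 'I_k -> 'I_m} =>
  [ffun i => spread p.1 p.2 i])) /=.
  rewrite big_mkcond; apply: eq_bigr => p _; rewrite inE.
  rewrite (occurrence_eq _ _ (g := spread p.1 p.2)); first by case: occurrence.
  by move=> i; rewrite ffunE.
exists (fun g : {ffun 'I_k -> 'I_(n * m)} =>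
   ([ffun i => block (g i)], [ffun i => offset (g i)])).
  move=> [b o] _; congr pair; apply/ffunP => i;
  by rewrite !ffunE /spread (block_pos, offset_pos).
by move=> g _; apply/ffunP => i; rewrite ffunE /spread !ffunE pos_block_offset.
Qed.

(** Sorting the offsets as [g \o alpha] and grouping the increasing maps [g]
    by the pattern [rho] they occupy in [sigma], each group contributes the
    same amount by [occurrence_spread]. *)
Lemma sum_injective_offsets k n m (pi : 'S_k) (tau : 'S_n) (sigma : 'S_m) :
  (\sum_(b : {ffun 'I_k -> 'I_n})
     \sum_(o : {ffun 'I_k -> 'I_m} | injectiveb o)
     occurrence pi (tensor tau sigma) (spread b o) =
   \sum_(rho : 'S_k) transfer_count pi tau rho * #|occurrences rho sigma|)%N.
Proof.
under eq_bigr => b _.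
  rewrite sum_injective.
  under eq_bigr do rewrite (sum_increasing sigma).
  rewrite exchange_big /=.
  over.
rewrite exchange_big /=; apply: eq_bigr => rho _.
rewrite big_distrl /=; apply: eq_bigr => b _.
rewrite big_distrl /=; apply: eq_bigr => alpha _.
rewrite [RHS]mulnC -sum_nat_const; apply: eq_bigr => g; rewrite inE => occ_g.
rewrite -(occurrence_spread _ _ _ _ occ_g).
by congr nat_of_bool; apply: occurrence_eq => i; rewrite /spread ffunE.
Qed.

Lemma ffact_le_expn m k : (m ^_ k <= m ^ k)%N.
Proof. by elim: k => // k IH; rewrite ffactnSr expnSr leq_mul // leq_subr. Qed.

(** Crude, but [m ^ k - m ^_ k] is at most of order [m ^ k.-1], hence negligible. *)
Lemma sum_colliding_offsets k n m (pi : 'S_k) (tau : 'S_n) (sigma : 'S_m) :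
  (\sum_(b : {ffun 'I_k -> 'I_n})
     \sum_(o : {ffun 'I_k -> 'I_m} | ~~ injectiveb o)
     occurrence pi (tensor tau sigma) (spread b o) <=
   n ^ k * (m ^ k - m ^_ k))%N.
Proof.
have -> : (n ^ k)%N = #|{ffun 'I_k -> 'I_n}| by rewrite card_ffun !card_ord.
rewrite -sum_nat_const leq_sum // => b _.
rewrite (@leq_trans (\sum_(o : {ffun 'I_k -> 'I_m} | ~~ injectiveb o) 1)%N) //.
  by apply: leq_sum => o _; case: occurrence.
rewrite sum1_card leq_subRL ?ffact_le_expn //.
have <- : #|[set f : {ffun 'I_k -> 'I_m} | injectiveb f]| = (m ^_ k)%N.
  by rewrite card_inj_ffuns !card_ord.
rewrite cardsE -[X in (_ <= X ^ _)%N]card_ord -[k in (_ <= _ ^ k)%N]card_ord.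
by rewrite -card_ffun -(cardC (fun f : {ffun 'I_k -> 'I_m} => injectiveb f)).
Qed.

Lemma card_occurrences_tensor_bounds k n m (pi : 'S_k) (tau : 'S_n) (sigma : 'S_m) :
  let main := (\sum_(rho : 'S_k)
                 transfer_count pi tau rho * #|occurrences rho sigma|)%N in
  (main <= #|occurrences pi (tensor tau sigma)| <=
     main + n ^ k * (m ^ k - m ^_ k))%N.
Proof.
rewrite /= card_occurrences_tensor -sum_injective_offsets.
under [X in (_ <= X <= _)%N]eq_bigr => b _ do
  rewrite (bigID (fun o : {ffun 'I_k -> 'I_m} => injectiveb o)) /=.
by rewrite big_split /= leq_addr leq_add2l sum_colliding_offsets.
Qed.

(** * Patterns of a uniform permutation *)

(** The extension permutes the image of [g] and fixes everything else. *)
Lemma perm_extension k m (g : 'I_k -> 'I_m) (rho : 'S_k) :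
  injective g -> exists s : 'S_m, forall i, s (g i) = g (rho i).
Proof.
move=> inj_g.
pose f x := if [pick i | g i == x] is Some i then g (rho i) else x.
have fg i : f (g i) = g (rho i).
  rewrite /f; case: pickP => [j /eqP /inj_g -> //|/(_ i)].
  by rewrite eqxx.
have fout x : (forall i, g i != x) -> f x = x.
  by move=> out; rewrite /f; case: pickP => // i; rewrite (negbTE (out i)).
have dec x : (exists i, x = g i) \/ (forall i, g i != x).
  have [/existsP[i /eqP <-]|/existsPn] := boolP [exists i, g i == x]; last by right.
  by left; exists i.
have f_inj : injective f.
  move=> x y; case: (dec x) => [[i ->]|ox]; case: (dec y) => [[j ->]|oy];
    rewrite ?fg ?fout //.
  - by move=> /inj_g /perm_inj ->.
  - by move=> e; have := oy (rho i); rewrite e eqxx.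
  - by move=> e; have := ox (rho j); rewrite e eqxx.
by exists (perm f_inj) => i; rewrite permE.
Qed.

(** By symmetry: rearranging the values at the positions in the image of [g]
    is a bijection of ['S_m] that exchanges the patterns on this image, so the
    [k!] patterns are equally frequent. *)
Lemma card_perm_occurrence k m (g : {ffun 'I_k -> 'I_m}) (rho : 'S_k) :
  increasing g -> (#|[set sigma : 'S_m | occurrence rho sigma g]| * k`! = m`!)%N.
Proof.
move=> inc_g.
have indep (pi : 'S_k) : #|[set sigma : 'S_m | occurrence pi sigma g]| =
                         #|[set sigma : 'S_m | occurrence rho sigma g]|.
  (* Precomposing with the extension [s] of [r] turns occurrences of [rho]
     along [g] into occurrences of [pi]. *)
  have [r piE] : exists r : 'S_k, forall i, pi i = rho (r i).
    by exists (pi * rho^-1)%g => i; rewrite -permM mulgKV.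
  have [s sg] := perm_extension r (increasing_inj inc_g).
  rewrite -(card_preimset _ (mulgI s)); apply: eq_card => t.
  rewrite !inE /occurrence inc_g /=.
  apply/same_orderP/same_orderP => h i j.
    have := h (r^-1 i)%g (r^-1 j)%g.
    by rewrite /= !permM !sg !piE !permKV.
  by rewrite !piE h /= !permM !sg.
transitivity (\sum_(pi : 'S_k) #|[set sigma : 'S_m | occurrence pi sigma g]|)%N.
  by rewrite (eq_bigr _ (fun pi _ => indep pi)) sum_nat_const card_Sn mulnC.
transitivity (\sum_(pi : 'S_k) \sum_(sigma : 'S_m) occurrence pi sigma g)%N.
  apply: eq_bigr => pi _; rewrite -sum1_card big_mkcond; apply: eq_bigr => t _.
  by rewrite inE; case: occurrence.
(* Each [sigma] takes exactly one pattern on [g]. *)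
rewrite exchange_big /= -[RHS](card_Sn m) -sum1_card; apply: eq_bigr => sigma _.
have inj : injective (sigma \o g).
  exact: inj_comp (@perm_inj _ _) (increasing_inj inc_g).
rewrite (bigD1 (standardization (sigma \o g))) //= big1 ?addn0.
  by rewrite /occurrence inc_g -standardization_eq ?eqxx.
move=> pi ne; rewrite /occurrence inc_g -standardization_eq //.
by rewrite eq_sym (negbTE ne).
Qed.

Lemma sum_card_occurrences k m (rho : 'S_k) :
  ((\sum_(sigma : 'S_m) #|occurrences rho sigma|) * k`! = 'C(m, k) * m`!)%N.
Proof.
have -> : (\sum_(sigma : 'S_m) #|occurrences rho sigma| =
  \sum_(g : {ffun 'I_k -> 'I_m} | increasing g)
    #|[set sigma : 'S_m | occurrence rho sigma g]|)%N.
  transitivity (\sum_(sigma : 'S_m)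
      \sum_(g : {ffun 'I_k -> 'I_m} | increasing g) occurrence rho sigma g)%N.
    apply: eq_bigr => sigma _; rewrite -sum1_card big_mkcond [RHS]big_mkcond.
    apply: eq_bigr => g _; rewrite inE /occurrence.
    by case: increasing => //=; case: same_order.
  rewrite exchange_big /=; apply: eq_bigr => g _.
  rewrite -sum1_card [RHS]big_mkcond; apply: eq_bigr => sigma _; rewrite inE.
  by case: occurrence.
rewrite big_distrl /= -(card_increasing k m) -sum1_card big_distrl /=.
rewrite big_mkcond [RHS]big_mkcond; apply: eq_bigr => g _; rewrite inE.
by case: ifP => // inc_g; rewrite card_perm_occurrence // mul1n.
Qed.

(** * Limits of sequences *)

Local Open Scope classical_set_scope.
Local Open Scope ring_scope.

Lemma cvg_close (R : realType) (f g e : nat -> R) (l : R) :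
  (forall j, `|f j - g j| <= e j) -> e j @[j --> \oo] --> 0 ->
  g j @[j --> \oo] --> l -> f j @[j --> \oo] --> l.
Proof.
move=> fg e0 gl.
have fg0 : f j - g j @[j --> \oo] --> 0.
  apply: norm_cvg0; apply: (squeeze_cvgr _ (cvg_cst 0) e0).
  by apply: nearW => j; rewrite normr_ge0 fg.
rewrite -[l]add0r (_ : f = fun j => (f j - g j) + g j); first exact: cvgD.
by apply/funext => j; rewrite subrK.
Qed.

Lemma near_eq_cvg_to (R : realType) (f g : nat -> R) (l : R) :
  {near \oo, f =1 g} -> f j @[j --> \oo] --> l -> g j @[j --> \oo] --> l.
Proof. by move=> fg fl; exact: cvg_trans (near_eq_cvg fg) fl. Qed.

Lemma cvg_falling_ratio (R : realType) k :
  (m ^_ k)%:R / (m ^ k)%:R @[m --> \oo] --> (1 : R).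
Proof.
elim: k => [|k IH].
  rewrite (_ : (fun _ => _) = cst 1); first exact: cvg_cst.
  by apply/funext => m; rewrite ffactn0 expn0 divr1.
have inv0 : m%:R^-1 @[m --> \oo] --> (0 : R).
  rewrite -(cvg_shiftS (fun m => m%:R^-1 : R)); exact: cvg_harmonic.
have factor1 : 1 - k%:R * m%:R^-1 @[m --> \oo] --> (1 : R).
  rewrite -[X in _ --> X]subr0 -[X in 1 - X](mulr0 k%:R).
  exact: cvgB (cvg_cst _) (cvgM (cvg_cst _) inv0).
have := cvgM IH factor1; rewrite mulr1 => /(_ _) lim; apply: near_eq_cvg_to lim.
near=> m.
have m_gt0 : (0 < m)%N by near: m; exact: nbhs_infty_gt.
have k_le : (k <= m)%N by near: m; exact: nbhs_infty_ge.
have m0 : m%:R != 0 :> R by rewrite pnatr_eq0 -lt0n.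
rewrite /= ffactnSr expnSr !natrM natrB // invfM mulrACA; congr (_ * _).
by rewrite mulrBl mulfV.
Unshelve. all: by end_near. Qed.

Lemma cvg_bin_ratio (R : realType) k n : (0 < n)%N ->
  'C(m, k)%:R / 'C(n * m, k)%:R @[m --> \oo] --> ((n ^ k)%:R^-1 : R).
Proof.
move=> n_gt0.
have scale : (n * m)%N @[m --> \oo] --> \oo.
  apply/cvgnyPge => A; near=> m; rewrite (@leq_trans m) ?leq_pmull //.
  by near: m; exact: nbhs_infty_ge.
have big : ((n * m) ^_ k)%:R / ((n * m) ^ k)%:R @[m --> \oo] --> (1 : R).
  exact: cvg_comp _ _ scale (@cvg_falling_ratio R k).
have : (m ^_ k)%:R / (m ^ k)%:R * (((n * m) ^_ k)%:R / ((n * m) ^ k)%:R)^-1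
    * (n ^ k)%:R^-1 @[m --> \oo] --> (1 * 1^-1 * (n ^ k)%:R^-1 : R).
  exact: cvgM (cvgM (@cvg_falling_ratio R k) (cvgV (oner_neq0 _) big))
    (cvg_cst _).
rewrite invr1 !mul1r => lim; apply: near_eq_cvg_to lim; near=> m.
have m_gt0 : (0 < m)%N by near: m; exact: nbhs_infty_gt.
have X0 (a b : nat) : (0 < a)%N -> (a ^ b)%:R != 0 :> R.
  by move=> a0; rewrite pnatr_eq0 -lt0n expn_gt0 a0.
rewrite /= -!bin_ffact !natrM expnMn natrM.
have f0 : k`!%:R != 0 :> R by rewrite pnatr_eq0 -lt0n fact_gt0.
rewrite !invfM !invrK.
set a := 'C(m, k)%:R; set b := 'C(n * m, k)%:R^-1.
by field; rewrite f0 !X0.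
Unshelve. all: by end_near. Qed.

Lemma cvg_collision_ratio (R : realType) k n : (0 < n)%N ->
  (n ^ k * (m ^ k - m ^_ k))%:R / 'C(n * m, k)%:R @[m --> \oo] --> (0 : R).
Proof.
move=> n_gt0.
(* Writing [q] for the falling ratio, the quotient is
   [k! * n^k * ('C(m,k) / 'C(nm,k)) * (1 / q - 1)], as
   [m ^ k - m ^_ k = m ^_ k * (1 / q - 1)]. *)
have lim : k`!%:R * (n ^ k)%:R * ('C(m, k)%:R / 'C(n * m, k)%:R) *
    (((m ^_ k)%:R / (m ^ k)%:R)^-1 - 1) @[m --> \oo] -->
    (k`!%:R * (n ^ k)%:R * (n ^ k)%:R^-1 * (1^-1 - 1) : R).
  exact: cvgM (cvgM (cvg_cst _) (@cvg_bin_ratio R k n n_gt0))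
    (cvgB (cvgV (oner_neq0 _) (@cvg_falling_ratio R k)) (cvg_cst _)).
move: lim; rewrite invr1 subrr mulr0 => lim; apply: near_eq_cvg_to lim.
near=> m.
have m_gt0 : (0 < m)%N by near: m; exact: nbhs_infty_gt.
have k_le : (k <= m)%N by near: m; exact: nbhs_infty_ge.
rewrite natrM natrB ?ffact_le_expn // -[in LHS]bin_ffact natrM.
have C0 : 'C(m, k)%:R != 0 :> R by rewrite pnatr_eq0 -lt0n bin_gt0.
have f0 : k`!%:R != 0 :> R by rewrite pnatr_eq0 -lt0n fact_gt0.
have X0 : (m ^ k)%:R != 0 :> R by rewrite pnatr_eq0 -lt0n expn_gt0 m_gt0.
rewrite -bin_ffact natrM.
set b := 'C(n * m, k)%:R^-1.
by field; rewrite X0 f0 C0.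
Unshelve. all: by end_near. Qed.

(** * The transfer formula *)

Section Transfer.
Variables (R : realType) (k n : nat) (pi : 'S_k) (tau : 'S_n).

(** The limit of the exact coefficient, which is [transfer_count] times the
    ratio of ['C(m, k)] to ['C(n * m, k)]. *)
Definition transfer_weight (rho : 'S_k) : R :=
  (transfer_count pi tau rho)%:R / (n ^ k)%:R.

(** The first summand pays for replacing the exact coefficients by their
    limits, the second for colliding offsets. *)
Definition transfer_error (m : nat) : R :=
  \sum_(rho : 'S_k) (transfer_count pi tau rho)%:R *
     `|'C(m, k)%:R / 'C(n * m, k)%:R - (n ^ k)%:R^-1| +
  (n ^ k * (m ^ k - m ^_ k))%:R / 'C(n * m, k)%:R.

Lemma cvg_transfer_error : (0 < n)%N -> transfer_error m @[m --> \oo] --> 0.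
Proof.
move=> n_gt0; have main : \sum_(rho : 'S_k) (transfer_count pi tau rho)%:R *
    `|'C(m, k)%:R / 'C(n * m, k)%:R - (n ^ k)%:R^-1| @[m --> \oo] -->
    (\sum_(rho : 'S_k) (transfer_count pi tau rho)%:R *
       `|(n ^ k)%:R^-1 - (n ^ k)%:R^-1| : R).
  apply: cvg_big => [|rho _]; first exact: add_continuous.
  have diff : 'C(m, k)%:R / 'C(n * m, k)%:R - (n ^ k)%:R^-1 @[m --> \oo] -->
      ((n ^ k)%:R^-1 - (n ^ k)%:R^-1 : R).
    exact: cvgB (@cvg_bin_ratio R k n n_gt0) (cvg_cst _).
  exact: cvgM (cvg_cst _) (cvg_norm diff).
have lim : transfer_error m @[m --> \oo] --> (\sum_(rho : 'S_k)
    (transfer_count pi tau rho)%:R * `|(n ^ k)%:R^-1 - (n ^ k)%:R^-1| + 0 : R).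
  exact: cvgD main (@cvg_collision_ratio R k n n_gt0).
move: lim; rewrite addr0 subrr normr0 big1 // => rho _; exact: mulr0.
Qed.

Lemma card_occurrences_le m (rho : 'S_k) (sigma : 'S_m) :
  (#|occurrences rho sigma| <= 'C(m, k))%N.
Proof.
rewrite -card_increasing subset_leq_card //; apply/fintype.subsetP => g.
by rewrite !inE => /andP[].
Qed.

(** This holds for [m < k] as well: both sides are then 0. *)
Lemma card_occurrences_density m (rho : 'S_k) (sigma : 'S_m) :
  #|occurrences rho sigma|%:R = density R rho sigma * 'C(m, k)%:R.
Proof.
rewrite density_occurrences; have := card_occurrences_le rho sigma.
have [->|C_gt0 _] := posnP 'C(m, k).
  by rewrite leqn0 => /eqP ->; rewrite mulr0.
by rewrite mulfVK // pnatr_eq0 -lt0n.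
Qed.

Lemma density_ge0 m (rho : 'S_k) (sigma : 'S_m) : 0 <= density R rho sigma.
Proof. by rewrite density_occurrences divr_ge0. Qed.

Lemma density_le1 m (rho : 'S_k) (sigma : 'S_m) : density R rho sigma <= 1.
Proof.
rewrite density_occurrences; have [->|C_gt0] := posnP 'C(m, k).
  by rewrite invr0 mulr0.
by rewrite ler_pdivrMr ?ltr0n // mul1r ler_nat card_occurrences_le.
Qed.

Lemma density_tensor_close m (sigma : 'S_m) :
  `|density R pi (tensor tau sigma) -
    \sum_(rho : 'S_k) transfer_weight rho * density R rho sigma| <=
  transfer_error m.
Proof.
set main := (\sum_(rho : 'S_k)
  transfer_count pi tau rho * #|occurrences rho sigma|)%N.
have /andP[lo hi] := card_occurrences_tensor_bounds pi tau sigma.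
rewrite -/main in lo hi.
rewrite density_occurrences -(subnKC lo) natrD mulrDl addrAC.
apply: le_trans (ler_normD _ _) _; apply: lerD; last first.
  rewrite ger0_norm; last by rewrite divr_ge0.
  by rewrite ler_wpM2r ?invr_ge0 ?ler0n // ler_nat leq_subLR.
rewrite natr_sum mulr_suml -sumrB.
apply: le_trans (ler_norm_sum _ _ _) _; apply: ler_sum => rho _.
rewrite natrM card_occurrences_density /transfer_weight.
set c := (transfer_count pi tau rho)%:R; set t := density R rho sigma.
set u := 'C(m, k)%:R / 'C(n * m, k)%:R.
have -> : c * (t * 'C(m, k)%:R) / 'C(n * m, k)%:R - c / (n ^ k)%:R * t =
    c * (u - (n ^ k)%:R^-1) * t by rewrite /u; ring.
rewrite normrM (ger0_norm (density_ge0 _ _)) normrM (ger0_norm (ler0n _ _)).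
by rewrite ler_piMr ?density_le1 // mulr_ge0 ?ler0n.
Qed.

Lemma cvg_density_tensor (N : nat -> nat) (sigma : forall j, 'S_(N j))
    (l : 'S_k -> R) :
  (0 < n)%N -> N j @[j --> \oo] --> \oo ->
  (forall rho, density R rho (sigma j) @[j --> \oo] --> l rho) ->
  density R pi (tensor tau (sigma j)) @[j --> \oo] -->
  \sum_(rho : 'S_k) transfer_weight rho * l rho.
Proof.
move=> n_gt0 Noo sigma_l.
apply: (cvg_close (fun j => density_tensor_close (sigma j))).
  exact: cvg_comp _ _ Noo (cvg_transfer_error n_gt0).
apply: cvg_big => [|rho _]; first exact: add_continuous.
by apply: cvgM; [exact: cvg_cst|exact: sigma_l].
Qed.

Lemma mean_density m (rho : 'S_k) : (k <= m)%N ->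
  (\sum_(sigma : 'S_m) density R rho sigma) / m`!%:R = k`!%:R^-1.
Proof.
move=> le_km.
have C0 : 'C(m, k)%:R != 0 :> R by rewrite pnatr_eq0 -lt0n bin_gt0.
have f0 j : j`!%:R != 0 :> R by rewrite pnatr_eq0 -lt0n fact_gt0.
under eq_bigr do rewrite density_occurrences.
rewrite -mulr_suml -natr_sum.
have /(congr1 (fun x => x%:R : R)) := sum_card_occurrences m rho.
rewrite !natrM => e.
rewrite -[X in X / _ / _](mulfK (f0 k)) e.
by field; rewrite C0 !f0.
Qed.

(** Averaging the transfer formula over [sigma] turns every density on the
    right into [1/k!], so the weights times [1/k!] sum to the limit of the
    averages on the left. *)
Lemma sum_transfer_weight :
  (0 < n)%N ->
  (\sum_(sigma : 'S_l.+1) density R pi (tensor tau sigma)) / l.+1`!%:R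
    @[l --> \oo] --> (k`!%:R^-1 : R) ->
  \sum_(rho : 'S_k) transfer_weight rho = 1.
Proof.
move=> n_gt0 mean_lim.
have f0 j : j`!%:R != 0 :> R by rewrite pnatr_eq0 -lt0n fact_gt0.
suff : \sum_(rho : 'S_k) transfer_weight rho * k`!%:R^-1 = k`!%:R^-1.
  by rewrite -mulr_suml -[RHS]mul1r => /(mulIf _) -> //; rewrite invr_eq0.
apply: (@cvg_unique _ (@Rhausdorff R)) mean_lim.
have close (l : nat) :
  `|(\sum_(sigma : 'S_l.+1) density R pi (tensor tau sigma)) / l.+1`!%:R -
    \sum_(rho : 'S_k) transfer_weight rho *
      ((\sum_(sigma : 'S_l.+1) density R rho sigma) / l.+1`!%:R)| <=
  transfer_error l.+1.
  have -> : \sum_(rho : 'S_k) transfer_weight rho *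
      ((\sum_(sigma : 'S_l.+1) density R rho sigma) / l.+1`!%:R) =
    (\sum_(sigma : 'S_l.+1) \sum_(rho : 'S_k)
      transfer_weight rho * density R rho sigma) / l.+1`!%:R.
    rewrite exchange_big mulr_suml; apply: eq_bigr => rho _.
    by rewrite mulrA mulr_sumr.
  rewrite -mulrBl -sumrB normrM normfV [X in _ / X]ger0_norm //.
  rewrite ler_pdivrMr ?ltr0n ?fact_gt0 //.
  apply: le_trans (ler_norm_sum _ _ _) _.
  apply: (@le_trans _ _ (\sum_(sigma : 'S_l.+1) transfer_error l.+1)).
    by apply: ler_sum => sigma _; exact: density_tensor_close.
  by rewrite sumr_const card_Sn mulr_natr.
apply: (cvg_close close).
  by rewrite (cvg_shiftS transfer_error); exact: cvg_transfer_error.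
apply: cvg_big => [|rho _]; first exact: add_continuous.
apply: cvgM; first exact: cvg_cst.
apply: near_eq_cvg_to (cvg_cst (k`!%:R^-1 : R)); near=> l.
rewrite /= mean_density //.
by near: l; exists k => // l /= /leqW.
Unshelve. all: by end_near. Qed.

End Transfer.

(** * Associativity of the tensor product *)

Lemma density_same_values (R : realType) k (pi : 'S_k) n n' (eq_n : n = n')
    (tau : 'S_n) (tau' : 'S_n') :
  (forall i, tau' (cast_ord eq_n i) = tau i :> nat) ->
  density R pi tau = density R pi tau'.
Proof.
case: n' / eq_n tau' => tau' same; congr density.
by apply/permP => i; apply: val_inj; rewrite /= -same cast_ord_id.
Qed.

Lemma density_tensorA (R : realType) k (pi : 'S_k) n1 n2 m
    (tau1 : 'S_n1) (tau2 : 'S_n2) (sigma : 'S_m) :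
  density R pi (tensor (tensor tau1 tau2) sigma) =
  density R pi (tensor tau1 (tensor tau2 sigma)).
Proof.
apply: (@density_same_values _ _ _ _ _ (esym (mulnA n1 n2 m))) => i.
rewrite !permE /= !permE /= mulnDl mulnA addnA.
congr (_ * _ * _ + _ * _ + _)%N; congr (nat_of_ord (_ _)); apply: val_inj => /=.
- by rewrite [(n2 * _)%N]mulnC divnMA.
- by rewrite modn_divl.
- by rewrite modn_dvdm // dvdn_mull.
Qed.

Lemma cvg_mulnS n : (0 < n)%N -> (n * j.+1)%N @[j --> \oo] --> \oo.
Proof.
move=> n_gt0; apply/cvgnyPge => A; near=> j.
rewrite (@leq_trans j.+1) ?leq_pmull // leqW //.
by near: j; exact: nbhs_infty_ge.
Unshelve. all: by end_near. Qed.

(** * Expected densities of a random inflation *)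

Section FiniteImage.
Variables (R : realType) (d : measure_display) (Omega : measurableType d).
Variables (P : probability Omega R) (T : finType) (X : Omega -> T).
Hypothesis X_meas : forall t, measurable (X @^-1` [set t]).

Lemma finite_image_indic (f : T -> R) (w : Omega) :
  (f (X w))%:E = \sum_(t : T) ((f t)%:E * (\1_(X @^-1` [set t]) w)%:E)%E.
Proof.
rewrite (bigD1 (X w)) //= big1 ?adde0.
  by rewrite indicE mem_set ?mule1.
move=> t tX; rewrite indicE memNset ?mule0 //=.
by move=> e; rewrite e eqxx in tX.
Qed.

Lemma measurable_finite_image (f : T -> R) :
  measurable_fun setT ((fun w => (f (X w))%:E) : Omega -> \bar R).
Proof.
under eq_fun do rewrite finite_image_indic.
apply: emeasurable_sum => t; apply: emeasurable_funM; first exact: measurable_cst.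
by apply/measurable_EFinP; exact: measurable_indic.
Qed.

Lemma integral_finite_image (f : T -> R) : (forall t, 0 <= f t) ->
  (\int[P]_w (f (X w))%:E = \sum_(t : T) (f t)%:E * P (X @^-1` [set t]))%E.
Proof.
move=> f_ge0; under eq_integral do rewrite finite_image_indic.
have ind_meas t : measurable_fun setT
      ((fun w => (\1_(X @^-1` [set t]) w)%:E) : Omega -> \bar R).
  by apply/measurable_EFinP; exact: measurable_indic.
rewrite ge0_integral_sum //.
- apply: eq_bigr => t _; rewrite ge0_integralZl //.
  + by rewrite integral_indic // setIT.
  + by rewrite lee_fin.
- by move=> t; apply: emeasurable_funM => //; exact: measurable_cst.
- by move=> t w _; rewrite mule_ge0 ?lee_fin //.
Qed.

End FiniteImage.

(** Almost sure convergence of densities, which are bounded by 1, implies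
    convergence of their expectations, and the expectation only depends on the
    law of [lambda l]. *)
Lemma inflatable_mean_density (R : realType) (k n : nat) (tau : 'S_n)
    (pi : 'S_k) d (Omega : measurableType d) (P : probability Omega R)
    (lambda : forall l, Omega -> 'S_l.+1) :
  (forall l, uniform_random_perm P (lambda l)) ->
  k_inflatable R k tau ->
  (\sum_(sigma : 'S_l.+1) density R pi (tensor tau sigma)) / l.+1`!%:R
    @[l --> \oo] --> (k`!%:R^-1 : R).
Proof.
move=> unif infl.
pose F l (sigma : 'S_l.+1) : R := density R pi (tensor tau sigma).
have fibers l sigma : measurable (lambda l @^-1` [set sigma]).
  by have [] := unif l sigma.
have [] := @dominated_convergence _ _ _ P setT measurableT
  (fun l w => (F l (lambda l w))%:E) (cst (k`!%:R^-1)%:E) (cst 1%:E).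
- by move=> l; exact: measurable_finite_image (fibers l) (F l).
- exact: measurable_cst.
- apply: filterS (infl _ _ _ _ unif) => w [_ _ sym] _.
  apply: cvg_EFin; first exact: nearW.
  exact: sym pi.
- exact: finite_measure_integrable_cst.
- apply: nearW => w l _ /=.
  by rewrite lee_fin ger0_norm ?density_ge0 // density_le1.
have -> : (\int[P]_w (cst (k`!%:R^-1)%:E : Omega -> \bar R) w = (k`!%:R^-1)%:E)%E.
  have P1 : measure_function.Measure.sort P setT = 1%:E := probability_setT P.
  by rewrite integral_cst // P1 mule1.
move=> _ _.
have intE l : (\int[P]_w (F l (lambda l w))%:E =
    ((\sum_(sigma : 'S_l.+1) F l sigma) / l.+1`!%:R)%:E)%E.
  rewrite (integral_finite_image P (fibers l)); last first.
    by move=> sigma; exact: density_ge0.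
  rewrite mulr_suml -sumEFin; apply: eq_bigr => sigma _.
  by have [_ ->] := unif l sigma; rewrite EFinM.
under eq_cvg do rewrite /= intE.
by move=> lim; exact: (fine_cvg lim).
Qed.

(** * Inflatability of the tensor product *)

Theorem theorem19 (R : realType) (k n1 n2 : nat)
    (tau1 : 'S_n1) (tau2 : 'S_n2) :
  (1 <= k)%N -> (1 <= n1)%N -> (1 <= n2)%N ->
  k_inflatable R k tau1 -> k_inflatable R k tau2 ->
  k_inflatable R k (tensor tau1 tau2).
Proof.
move=> _ n1_gt0 n2_gt0 infl1 infl2 d Omega P lambda unif.
apply: filterS (infl2 _ _ _ _ unif) => w [_ conv sym2].
have inner_oo := cvg_mulnS n2_gt0.
have assoc m (pi : 'S_m) :
    (fun j => density R pi (random_inflation (tensor tau1 tau2) lambda w j)) =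
    (fun j => density R pi (tensor tau1 (random_inflation tau2 lambda w j))).
  by apply/funext => j; exact: density_tensorA.
split.
- by apply: cvg_mulnS; rewrite muln_gt0 n1_gt0.
- move=> m pi m_gt0; rewrite assoc.
  exact: cvgP (cvg_density_tensor n1_gt0 inner_oo
    (fun rho => conv m rho m_gt0)).
move=> pi; rewrite assoc.
have weights := sum_transfer_weight n1_gt0 (inflatable_mean_density pi unif infl1).
rewrite -[X in _ --> X]mul1r -[X in X * _^-1]weights mulr_suml.
exact: (cvg_density_tensor (l := fun=> k`!%:R^-1) n1_gt0 inner_oo sym2).
Qed.
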